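(* For every integer $g\ge 3$, $(g,g-1)$-reverse multiples exist, and the $(g,g-1)$ Young graph is the 1089 graph.
   Context: Notation: $(a_{n-1},\dots,a_1,a_0)_g$ denotes $\sum_{i=0}^{n-1}a_ig^i$ with digits $0\le a_i<g$. For integers $g\ge3$, $2\le k<g$, a positive integer $N=(a_{n-1},\dots,a_0)_g$ with $a_{n-1}\neq 0$ is a $(g,k)$-reverse multiple if $kN=(a_0,a_1,\dots,a_{n-1})_g$ (the base-$g$ reversal of $N$). Young graph. The directed edge-labelled graph $H(g,k)$ is defined as follows. Its possible nodes are a distinguished starting node, written $[[0,0]]$, and ordered pairs $[s,r]$ of integers with $0\le s,r\le k-1$ (the pair $[0,0]$ is a node distinct from the starting node). For a node $[s,r]$ (the starting node being treated as $s=r=0$) and each pair of digits $(c,a)$, $0\le a,c\le g-1$, with $ka+r\equiv c \pmod g$ and $0\le a+sg-kc\le k-1$, there is a directed edge labelled $(c,a)$ from $[s,r]$ to the node $[\,a+sg-kc,\ (ka+r-c)/g\,]$; for edges leaving the starting node one additionally requires $a\ne0$ and $c\ne0$. $H(g,k)$ consists of the starting node, the nodes reachable from it by directed paths, and all edges leaving these nodes. A non-starting node of the form $[r,r]$ ($r\ge0$, including $[0,0]$) is an even pivot node; a non-starting node is an odd pivot node if it is of the form $[r,r]$ and carries a loop, or is of the form $[r',r]$ with $r'\ne r$ and has an edge to $[r,r']$. The $(g,k)$ Young graph exists if $H(g,k)$ contains a node $[r,r]$ with $r\ne0$ or an edge $[r',r]\to[r,r']$ with $r'\ne r$; it is then obtained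 from $H(g,k)$ by deleting every node from which no pivot node can be reached by a directed path, together with all edges incident to such nodes. Two Young graphs are isomorphic if there is an isomorphism of the underlying (unlabelled) directed graphs sending starting node to starting node, even pivot nodes onto even pivot nodes and odd pivot nodes onto odd pivot nodes. The 1089 graph: a Young graph is ''the 1089 graph'' if it is isomorphic to the graph with starting node $S$ and non-starting nodes $U,V,W,X$, with edges $S\to V$, $U\to U$, $U\to V$, $V\to W$, $W\to W$, $W\to X$, $X\to U$, in which $U$ and $W$ are both even and odd pivot nodes and $V,X$ are not pivot nodes. *)

(* Defs.v *)
From mathcomp Require Import all_boot.
From mathcomp Require Import zify.

Set Implicit Arguments.
Unset Strict Implicit.
Unset Printing Implicit Defensive.

(* Digit sequences are little-endian: [nth 0 a i] is the coefficient of g^i. *)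
Definition digits_value (g : nat) (a : seq nat) : nat :=
  \sum_(i < size a) nth 0 a i * g ^ i.

Definition reverse_multiple (g k N : nat) : Prop :=
  0 < N /\
  exists a : seq nat,
    [/\ all (fun d => d < g) a, last 0 a != 0,
        N = digits_value g a & k * N = digits_value g (rev a)].

(* [None] is the starting node [[0,0]]; [Some (s, r)] is the node [s,r]. *)
Notation ynode k := (option ('I_k * 'I_k)).

Definition ystart {k : nat} : ynode k := None.

Definition ypair {k : nat} (s r : 'I_k) : ynode k := Some (s, r).

Definition carries (k : nat) (u : ynode k) : nat * nat :=
  if u is Some (s, r) then (nat_of_ord s, nat_of_ord r) else (0, 0).

(* The bounds 0 <= a + s g - k c <= k - 1 are the inequality below together
   with the fact that its value is the ordinal s' : 'I_k.  In the last equation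
   the subtraction is exact, because c is the remainder of k a + r modulo g. *)
Definition labelled_edge (g k : nat) (u v : ynode k) (c a : 'I_g) : bool :=
  let: (s, r) := carries u in
  [&& (u == ystart) ==> ((a != 0 :> nat) && (c != 0 :> nat)),
      k * a + r == c %[mod g],
      k * c <= a + s * g &
      if v is Some (s', r') then
        (s' == a + s * g - k * c :> nat) && (r' == (k * a + r - c) %/ g :> nat)
      else false].

Definition yedge (g k : nat) : rel (ynode k) :=
  fun u v => [exists c : 'I_g, exists a : 'I_g, labelled_edge u v c a].

(* There are no parallel edges, so forgetting the labels loses no multiplicity
   and the underlying directed graph is given by the relation [yedge]. *)
Lemma labelled_edge_inj (g k : nat) (u v : ynode k) (c a c' a' : 'I_g) :
  1 < k -> labelled_edge u v c a -> labelled_edge u v c' a' ->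
  c = c' /\ a = a'.
Proof.
move=> k1; rewrite /labelled_edge; case: (carries u) => s r.
case: v => [[s' r']|]; last by rewrite !andbF.
have mod_eq (x y : 'I_g) : k * x + r == y %[mod g] ->
    k * x + r = (k * x + r - y) %/ g * g + y.
  rewrite (modn_small (ltn_ord y)) => /eqP <-; set m := k * x + r.
  by rewrite [in X in X - _](divn_eq m g) addnK mulnK -?divn_eq // (leq_ltn_trans _ (ltn_ord x)).
move=> /and4P[_ /mod_eq e1 l1 /andP[/eqP s1 /eqP r1]].
move=> /and4P[_ /mod_eq e2 l2 /andP[/eqP s2 /eqP r2]].
rewrite -r1 in e1; rewrite -r2 in e2.
have f1 : s' + k * c = a + s * g by lia.
have f2 : s' + k * c' = a' + s * g by lia.
have [cc aa] : c = c' :> nat /\ a = a' :> nat.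
  move: f1 f2 e1 e2; clear -k1; move: (r' * g) (s * g) => x y.
  move: (nat_of_ord c) (nat_of_ord c') (nat_of_ord a) (nat_of_ord a').
  move=> {}c {}c' {}a {}a' f1 f2 e1 e2.
  have h1 : k * c + a' = k * c' + a by lia.
  have h2 : k * a + c' = k * a' + c by lia.
  have [lt|lt|eq] := ltngtP c c'; last by split=> //; subst c'; lia.
  - have [d def] : exists d, c' = c + d.+1 by exists (c' - c).-1; lia.
    have : a' = a + k * d.+1 by subst c'; lia.
    by move=> ?; subst a' c'; nia.
  - have [d def] : exists d, c = c' + d.+1 by exists (c - c').-1; lia.
    have : a = a' + k * d.+1 by subst c; lia.
    by move=> ?; subst a c; nia.
by split; apply: val_inj.
Qed.

Definition H_node (g k : nat) (u : ynode k) : bool := connect (@yedge g k) ystart u.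

Definition even_pivot (g k : nat) (u : ynode k) : bool :=
  H_node g u && (if u is Some (s, r) then s == r else false).

Definition odd_pivot (g k : nat) (u : ynode k) : bool :=
  H_node g u &&
  (if u is Some (s, r) then
     (s == r) && yedge g u u || (s != r) && yedge g u (ypair r s)
   else false).

Definition young_exists (g k : nat) : bool :=
  [exists s : 'I_k, exists r : 'I_k,
     H_node g (ypair s r) &&
     ((s == r) && (r != 0 :> nat)
      || (s != r) && yedge g (ypair s r) (ypair r s))].

(* Paths may have length 0, so a pivot node reaches a pivot node. *)
Definition young_node (g k : nat) (u : ynode k) : bool :=
  H_node g u &&
  [exists p : ynode k,
     connect (@yedge g k) u p && (even_pivot g p || odd_pivot g p)].

Lemma young_node_start (g k : nat) :
  young_exists g k -> young_node g (@ystart k).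
Proof.
case/existsP=> s /existsP[r /andP[Hsr piv]].
rewrite /young_node {1}/H_node connect0 /=; apply/existsP; exists (ypair s r).
rewrite -/(H_node g _) Hsr /even_pivot /odd_pivot Hsr /=.
by case/orP: piv => /andP[-> // ->]; rewrite !orbT.
Qed.

Record pivot_graph := PivotGraph {
  pg_node : finType;
  pg_edge : rel pg_node;
  pg_start : pg_node;
  pg_even : pred pg_node;
  pg_odd : pred pg_node
}.

Definition pivot_graph_iso (G G' : pivot_graph) : Prop :=
  exists f : pg_node G -> pg_node G',
    [/\ bijective f,
        forall u v, pg_edge (f u) (f v) = pg_edge u v,
        f (pg_start G) = pg_start G',
        forall u, pg_even (f u) = pg_even u &
        forall u, pg_odd (f u) = pg_odd u].

Definition young_graph (g k : nat) (h : young_exists g k) : pivot_graph :=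
  @PivotGraph {u : ynode k | young_node g u}
    (fun u v => yedge g (val u) (val v))
    (exist _ ystart (young_node_start h))
    (fun u => even_pivot g (val u))
    (fun u => odd_pivot g (val u)).

(* The vertices S, U, V, W, X are numbered 0, 1, 2, 3, 4. *)
Definition graph1089 : pivot_graph :=
  @PivotGraph 'I_5
    (fun i j => (nat_of_ord i, nat_of_ord j) \in
       [:: (0, 2); (1, 1); (1, 2); (2, 3); (3, 3); (3, 4); (4, 1)])
    ord0
    (fun i => nat_of_ord i \in [:: 1; 3])
    (fun i => nat_of_ord i \in [:: 1; 3]).

Definition young_graph_is_1089 (g k : nat) : Prop :=
  exists h : young_exists g k, pivot_graph_iso (young_graph h) graph1089.

(* Main.v *)
Require Import Defs.
From mathcomp Require Import all_boot.
From mathcomp Require Import zify.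

Set Implicit Arguments.
Unset Strict Implicit.
Unset Printing Implicit Defensive.

(** For k = g - 1 the two equations k a + r = c + r' g and
    a + s g = s' + k c say that a + c is congruent to both r and s' modulo g,
    hence s' = r and a + c is r or r + g.  In the first case c = s and
    r' = r - s; in the second c = s + 1 and r' = r - s + (g - 2).  The walk from
    the starting node therefore only meets
    [0,g-2] -> [g-2,g-2] -> [g-2,0] -> [0,0], with loops at [g-2,g-2] and [0,0]
    and an edge from [0,0] back to [0,g-2].  The reverse multiple is the base-g
    analogue 1 0 (g-2) (g-1) of 1089. *)

Lemma digits_value_nil (g : nat) : digits_value g [::] = 0.
Proof. by rewrite /digits_value big_ord0. Qed.

Lemma digits_value_cons (g d : nat) (a : seq nat) :
  digits_value g (d :: a) = d + g * digits_value g a.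
Proof.
rewrite /digits_value big_ord_recl /= muln1 big_distrr; congr (_ + _).
by apply: eq_bigr => i _; rewrite /bump /= add1n expnS mulnCA.
Qed.

Lemma reverse_multiple_1089 (n : nat) :
  exists N, reverse_multiple n.+3 n.+2 N.
Proof.
(* Units digit first, so with g = n + 3 this is 1 0 (g-2) (g-1); for g = 10 it is 1089, and 9 times
   1089 is 9801. *)
set a := [:: n.+2; n.+1; 0; 1]; exists (digits_value n.+3 a).
split; last exists a; first by rewrite digits_value_cons.
split=> //=; first by lia.
by rewrite /rev /= !digits_value_cons digits_value_nil; nia.
Qed.

(** Replaces the congruence and the truncated subtraction by one exact equation: division of [m] by
    [g] with remainder [c] and quotient [q]. *)
Lemma carry_equation (g m c q : nat) : c < g ->
  (m == c %[mod g]) && (q == (m - c) %/ g) = (m == c + q * g).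
Proof.
move=> c_lt; rewrite (modn_small c_lt); apply/andP/eqP => [[/eqP <- /eqP ->]|->].
  by rewrite [in X in X - _](divn_eq m g) addnK mulnK ?(leq_ltn_trans _ c_lt) // addnC
     -divn_eq.
by rewrite addnC modnMDl (modn_small c_lt) addnK mulnK // (leq_ltn_trans _ c_lt).
Qed.

Lemma carry_digits (n s r s' r' a c : nat) :
  s < n.+2 -> r < n.+2 -> s' < n.+2 -> r' < n.+2 -> a < n.+3 -> c < n.+3 ->
  n.+2 * a + r = c + r' * n.+3 -> s' + n.+2 * c = a + s * n.+3 ->
  s' = r /\ (a = r' /\ c = s \/ a = r'.+1 /\ c = s.+1).
Proof.
move=> hs hr hs' hr' ha hc e f.
(* Adding [a] to [e] and [c] to [f] turns both into divisions of a + c by g, with remainders r, s'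
   and quotients a - r', c - s. Uniqueness equates them, and a + c < 2g bounds the quotient by 1. *)
have e' : a + c + r' * n.+3 = r + a * n.+3 by lia.
have f' : a + c + s * n.+3 = s' + c * n.+3 by lia.
have r'_le : r' <= a by rewrite leqNgt; apply/negP=> lt; nia.
have s_le : s <= c by rewrite leqNgt; apply/negP=> lt; nia.
have [d def_a] : exists d, a = r' + d by exists (a - r'); lia.
have [j def_c] : exists j, c = s + j by exists (c - s); lia.
have ed : a + c = r + d * n.+3 by subst; lia.
have ej : a + c = s' + j * n.+3 by subst; lia.
have d_lt : d < 2 by rewrite ltnNge; apply/negP=> lt; nia.
have j_lt : j < 2 by rewrite ltnNge; apply/negP=> lt; nia.
by case: d j d_lt j_lt ed ej def_a def_c => [|[|]] [|[|]] //; lia.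
Qed.

(** Eliminates the labels. The alternative with quotient 0 has c = s, which is 0 at the starting
    node and so forbidden there; hence the guard [isSome u]. *)
Lemma yedge_complement (n : nat) (u : ynode n.+2) (s' r' : 'I_n.+2) :
  yedge n.+3 u (ypair s' r') =
  let: (s, r) := carries u in
  (s' == r :> nat) &&
  (isSome u && (s + r' == r) || (s + r' == r + n.+1)).
Proof.
have -> : isSome u = (u != ystart) by case: u.
have carry_lt : (carries u).1 < n.+2 /\ (carries u).2 < n.+2.
  by case: u => [[s r]|] //=; rewrite !ltn_ord.
have start0 : u = ystart -> (carries u).1 = 0 /\ (carries u).2 = 0.
  by move=> ->.
rewrite /yedge /labelled_edge /=; case: (carries u) carry_lt start0 => s r /=.
move=> [s_lt r_lt] start0; have [s'_lt r'_lt] := (ltn_ord s', ltn_ord r').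
have edgeE (c a : 'I_n.+3) :
    [&& (u == ystart) ==> ((a != 0 :> nat) && (c != 0 :> nat)),
        n.+2 * a + r == c %[mod n.+3], n.+2 * c <= a + s * n.+3,
        s' == a + s * n.+3 - n.+2 * c :> nat
      & r' == (n.+2 * a + r - c) %/ n.+3 :> nat]
  = [&& (u == ystart) ==> ((a != 0 :> nat) && (c != 0 :> nat)),
        n.+2 * a + r == c + r' * n.+3
      & s' + n.+2 * c == a + s * n.+3].
  rewrite -carry_equation //; congr (_ && _); rewrite -andbA; congr (_ && _).
  rewrite andbA andbC; congr (_ && _); lia.
apply/existsP/andP => [[c /existsP[a]]|[/eqP s'E]].
  rewrite edgeE => /and3P[nz /eqP e /eqP f].
  have [-> digits] :=
    carry_digits s_lt r_lt s'_lt r'_lt (ltn_ord a) (ltn_ord c) e f.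
  split=> //; case: digits => [[aE cE]|[aE cE]]; apply/orP; [left|right].
    apply/andP; split; last by apply/eqP; nia.
    by apply/eqP=> us; move: nz; have [s0 _] := start0 us; rewrite us eqxx cE s0 andbF.
  by apply/eqP; nia.
case/orP=> [/andP[/negbTE u_nstart /eqP rE]|/eqP rE].
  (* The labels are (s, r') here and (s+1, r'+1) in the other case; s and r' are at most g - 2, so
     [inord] keeps these values. *)
  exists (inord s); apply/existsP; exists (inord r').
  by rewrite edgeE u_nstart !inordK; lia.
exists (inord s.+1); apply/existsP; exists (inord r'.+1).
by rewrite edgeE !inordK; lia.
Qed.

Lemma yedge_to_start (g k : nat) (u : ynode k) : yedge g u ystart = false.
Proof.
apply/existsP=> -[c /existsP[a]]; rewrite /labelled_edge.
by case: (carries u) => s r; rewrite !andbF.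
Qed.

(** The order is S, U, V, W, X, and [ord_max] is the carry g - 2. *)
Definition node1089 (n : nat) (i : 'I_5) : ynode n.+2 :=
  nth ystart [:: ystart; ypair ord0 ord0; ypair ord0 ord_max;
                 ypair ord_max ord_max; ypair ord_max ord0] i.

Lemma node1089_inj (n : nat) : injective (@node1089 n).
Proof.
by do 2!case=> [[|[|[|[|[|?]]]]] ?] //; move=> // ?; apply: val_inj.
Qed.

Lemma yedge_node1089 (n : nat) (i j : 'I_5) :
  yedge n.+3 (node1089 n i) (node1089 n j) = pg_edge (p := graph1089) i j.
Proof.
case: i j => [[|[|[|[|[|?]]]]] ?] // [[|[|[|[|[|?]]]]] ?] //;
  rewrite /node1089 /= ?yedge_to_start // yedge_complement /= !inE !xpair_eqE /=; lia.
Qed.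

(** If both carries lie in {0, g-2}, then s' = r does too, and r' is a multiple of g - 2 between 0
    and g - 2. *)
Lemma yedge_from_node1089 (n : nat) (i : 'I_5) (v : ynode n.+2) :
  yedge n.+3 (node1089 n i) v -> v \in codom (@node1089 n).
Proof.
case: v => [[s r]|]; last by rewrite yedge_to_start.
rewrite yedge_complement => e.
have [s_lt r_lt] := (ltn_ord s, ltn_ord r).
have {e}[s0 r0] : (s = 0 :> nat \/ s = n.+1 :> nat)
    /\ (r = 0 :> nat \/ r = n.+1 :> nat).
  by case: i e => [[|[|[|[|[|?]]]]] ?] //=; rewrite /node1089 /=; lia.
have bE (x : 'I_n.+2) : x = 0 :> nat \/ x = n.+1 :> nat -> x = ord0 \/ x = ord_max.
  by case=> e; [left|right]; apply: val_inj.
apply/codomP; case/bE: s0 => ->; case/bE: r0 => ->.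
- by exists (@Ordinal 5 1 isT).
- by exists (@Ordinal 5 2 isT).
- by exists (@Ordinal 5 4 isT).
- by exists (@Ordinal 5 3 isT).
Qed.

Lemma H_node_node1089 (n : nat) (i : 'I_5) : H_node n.+3 (node1089 n i).
Proof.
have step (j l : 'I_5) : pg_edge (p := graph1089) j l ->
    H_node n.+3 (node1089 n j) -> H_node n.+3 (node1089 n l).
  by rewrite -(yedge_node1089 n) => e /connect_trans; apply; apply: connect1.
have h0 : H_node n.+3 (node1089 n ord0) by apply: connect0.
pose U := @Ordinal 5 1 isT; pose V := @Ordinal 5 2 isT.
pose W := @Ordinal 5 3 isT; pose X := @Ordinal 5 4 isT.
(* The nodes are reached along S, V, W, X, U. *)
have h2 := step ord0 V isT h0; have h3 := step V W isT h2.
have h4 := step W X isT h3; have h1 := step X U isT h4.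
by case: i => [[|[|[|[|[|?]]]]] ?].
Qed.

Lemma H_nodeE (n : nat) (u : ynode n.+2) :
  H_node n.+3 u = (u \in codom (@node1089 n)).
Proof.
apply/idP/codomP=> [/connectP[p]|[i ->]]; last exact: H_node_node1089.
have : (@ystart n.+2) \in codom (@node1089 n) by apply/codomP; exists ord0.
(* The source of the path is generalized to any of the five nodes, a set closed under edges. *)
elim: p ystart => [|v p IHp] w /codomP[i wE] /=; first by move=> _ ->; exists i.
by rewrite {1}wE => /andP[/yedge_from_node1089 vP]; apply: IHp.
Qed.

Lemma even_pivot_node1089 (n : nat) (i : 'I_5) :
  even_pivot n.+3 (node1089 n i) = pg_even (p := graph1089) i.
Proof.
by rewrite /even_pivot H_node_node1089; case: i => [[|[|[|[|[|?]]]]] ?] //=;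
  rewrite eqxx.
Qed.

(** U and W carry loops, while V and X are each other's swap but no edge joins them. *)
Lemma odd_pivot_node1089 (n : nat) (i : 'I_5) :
  odd_pivot n.+3 (node1089 n i) = pg_odd (p := graph1089) i.
Proof.
rewrite /odd_pivot H_node_node1089.
by case: i => [[|[|[|[|[|?]]]]] ?] //=; rewrite /node1089 /= !yedge_complement /=
   -?val_eqE !inE /=; lia.
Qed.

(** Pruning deletes nothing: every node reaches U or W. *)
Lemma young_node_node1089 (n : nat) (i : 'I_5) :
  young_node n.+3 (node1089 n i).
Proof.
rewrite /young_node H_node_node1089 /=; apply/existsP.
have step (j l : 'I_5) : pg_edge (p := graph1089) j l ->
    connect (@yedge n.+3 n.+2) (node1089 n j) (node1089 n l).
  by rewrite -(yedge_node1089 n) => /connect1.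
pose U := @Ordinal 5 1 isT; pose V := @Ordinal 5 2 isT; pose W := @Ordinal 5 3 isT.
have piv (j : 'I_5) : pg_even (p := graph1089) j ->
    connect (@yedge n.+3 n.+2) (node1089 n i) (node1089 n j) ->
    exists p, connect (@yedge n.+3 n.+2) (node1089 n i) p
      && (even_pivot n.+3 p || odd_pivot n.+3 p).
  by move=> ev ij; exists (node1089 n j); rewrite ij even_pivot_node1089 ev.
case: i piv => [[|[|[|[|[|?]]]]] ?] // piv.
- apply: (piv W) => //; apply: connect_trans (step V W isT); exact: step.
- by apply: (piv U) => //; apply: step.
- by apply: (piv W) => //; apply: step.
- by apply: (piv W) => //; apply: step.
- by apply: (piv U) => //; apply: step.
Qed.

Lemma young_exists_complement (n : nat) : young_exists n.+3 n.+2.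
Proof.
(* The witness is W = [g-2, g-2], with g - 2 nonzero. *)
apply/existsP; exists ord_max; apply/existsP; exists ord_max.
by rewrite (H_node_node1089 n (@Ordinal 5 3 isT)) eqxx.
Qed.

(** Allows the isomorphism to be given by [node1089], which goes from [graph1089] to the Young
    graph. *)
Lemma pivot_graph_iso_sym (G G' : pivot_graph) :
  pivot_graph_iso G G' -> pivot_graph_iso G' G.
Proof.
case=> f [[h fK hK] fE fS fev fodd]; exists h; split.
- by exists f.
- by move=> u v; rewrite -fE !hK.
- by rewrite -fS fK.
- by move=> u; rewrite -fev hK.
- by move=> u; rewrite -fodd hK.
Qed.

Lemma young_graph_complement_is_1089 (n : nat) : young_graph_is_1089 n.+3 n.+2.
Proof.
exists (young_exists_complement n); apply: pivot_graph_iso_sym.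
exists (fun i : 'I_5 => exist _ (node1089 n i) (young_node_node1089 n i)).
split=> /= [|i j||i|i].
(* Every Young graph node lies in H, hence in the image of [node1089]; this supplies the inverse
   map. *)
- have img (u : {u : ynode n.+2 | young_node n.+3 u}) :
      val u \in codom (@node1089 n).
    by rewrite -H_nodeE; case/andP: (valP u).
  exists (fun u => iinv (img u)) => [i|u].
    by apply: (@node1089_inj n); rewrite f_iinv.
  by apply: val_inj; rewrite /= f_iinv.
- exact: yedge_node1089.
- exact: val_inj.
- exact: even_pivot_node1089.
- exact: odd_pivot_node1089.
Qed.

Theorem theorem3 (g : nat) (hg : 3 <= g) :
  (exists N : nat, reverse_multiple g (g - 1) N) /\
  young_graph_is_1089 g (g - 1).
Proof.
case: g hg => [|[|[|n]]] // _; rewrite subn1.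
by split; [apply: reverse_multiple_1089 | apply: young_graph_complement_is_1089].
Qed.
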